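(* Let $A\in\mathbb{R}^{n\times d}$ and $b\in\mathbb{R}^n$. Suppose that $S\in\mathbb{R}^{m\times n}$ is an $\epsilon$-subspace embedding for the augmented matrix $(A\ \ b)\in\mathbb{R}^{n\times(d+1)}$ for some $0<\epsilon<1$. Let $$SA=QR\hat V^T,\qquad R=\begin{pmatrix}R_{11}&R_{12}\\0&0\end{pmatrix}\in\mathbb{R}^{d\times d},\quad Q=(Q_1\ \ Q_2)\in\mathbb{R}^{m\times d},\quad \hat V=(V_1\ \ V_2)\in\mathbb{R}^{d\times d},$$ where $R_{11}\in\mathbb{R}^{p\times p}$ is nonsingular, $Q_1\in\mathbb{R}^{m\times p}$ and $Q_2\in\mathbb{R}^{m\times(d-p)}$ have orthonormal columns, and $\hat V$ is orthogonal with $V_1\in\mathbb{R}^{d\times p}$. Let $W=AV_1R_{11}^{-1}\in\mathbb{R}^{n\times p}$ and $y_*=\arg\min_{y\in\mathbb{R}^p}\|Wy-b\|_2$. If $R_{12}=0$, $y_\tau=y_*$ and $x_\tau=V_1R_{11}^{-1}y_\tau$, then $x_\tau=x_{*,2}$, where $x_{*,2}$ is the minimal Euclidean norm solution of $\min_{x\in\mathbb{R}^d}\|Ax-b\|_2$, i.e. the minimiser of $\|x_*\|_2$ over all $x_*\in\mathbb{R}^d$ with $\|Ax_*-b\|_2=\min_x\|Ax-b\|_2$.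
   Context: $S$ is an $\epsilon$-subspace embedding for a matrix $B\in\mathbb{R}^{n\times k}$ if $(1-\epsilon)\|Bz\|_2^2\le\|SBz\|_2^2\le(1+\epsilon)\|Bz\|_2^2$ for all $z\in\mathbb{R}^k$. The matrix $A$ may be rank deficient. *)

(* Defs.v *)
From mathcomp Require Import all_boot all_order all_algebra.
From mathcomp Require Import reals.

Set Implicit Arguments.
Unset Strict Implicit.
Unset Printing Implicit Defensive.

Import Order.TTheory GRing.Theory Num.Theory.
Local Open Scope ring_scope.

(* The norm that MathComp-Analysis puts on matrices is the maximum norm, so the
   Euclidean norm is defined here. *)
Definition norm2 (K : realType) (n : nat) (v : 'cV[K]_n) : K :=
  Num.sqrt (\sum_(i < n) v i 0 ^+ 2).

Definition subspace_embedding (K : realType) (m n k : nat) (eps : K)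
    (S : 'M[K]_(m, n)) (B : 'M[K]_(n, k)) : Prop :=
  forall z : 'cV[K]_k,
    (1 - eps) * norm2 (B *m z) ^+ 2 <= norm2 (S *m B *m z) ^+ 2 /\
    norm2 (S *m B *m z) ^+ 2 <= (1 + eps) * norm2 (B *m z) ^+ 2.

Definition orthonormal_columns (K : realType) (n k : nat)
    (U : 'M[K]_(n, k)) : Prop :=
  U^T *m U = 1%:M.

Definition orthogonal_mx (K : realType) (n : nat) (U : 'M[K]_n) : Prop :=
  U^T *m U = 1%:M /\ U *m U^T = 1%:M.

Definition minimizer_on (K : realType) (T : Type) (P : T -> Prop) (f : T -> K)
    (x : T) : Prop :=
  P x /\ forall z : T, P z -> f x <= f z.

Definition lsq_solution (K : realType) (n k : nat) (B : 'M[K]_(n, k))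
    (b : 'cV[K]_n) (x : 'cV[K]_k) : Prop :=
  minimizer_on (fun _ => True) (fun z => norm2 (B *m z - b)) x.

Definition min_norm_lsq_solution (K : realType) (n k : nat)
    (B : 'M[K]_(n, k)) (b : 'cV[K]_n) (x : 'cV[K]_k) : Prop :=
  minimizer_on (lsq_solution B b) (@norm2 K k) x.

(* Main.v *)
(* With R12 = 0 we have S A V2 = 0, so the embedding forces A V2 = 0; hence A
   factors as W R11 V1^T and xtau solves the least squares problem.  Any two
   least squares solutions have the same image under A, hence under
   S A = Q1 R11 V1^T, so they share the component V1^T x.  Since V2^T xtau = 0,
   the Pythagorean identity |x|^2 = |V1^T x|^2 + |V2^T x|^2 makes xtau the only
   solution of least norm. *)
Require Import Defs.
From mathcomp Require Import all_boot all_order all_algebra.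
From mathcomp Require Import reals ring lra.

Set Implicit Arguments.
Unset Strict Implicit.
Unset Printing Implicit Defensive.

Import Order.TTheory GRing.Theory Num.Theory.
Local Open Scope ring_scope.

Lemma norm2_ge0 (K : realType) n (v : 'cV[K]_n) : 0 <= norm2 v.
Proof. exact: sqrtr_ge0. Qed.

Lemma sqr_norm2 (K : realType) n (v : 'cV[K]_n) :
  norm2 v ^+ 2 = \sum_(i < n) v i 0 ^+ 2.
Proof. by rewrite sqr_sqrtr // sumr_ge0 // => i _; rewrite sqr_ge0. Qed.

(** In Gram form, orthogonality and block identities can be rewritten inside a norm. *)
Lemma sqr_norm2_mx (K : realType) n (v : 'cV[K]_n) :
  norm2 v ^+ 2 = (v^T *m v) 0 0.
Proof. by rewrite sqr_norm2 mxE; apply: eq_bigr => i _; rewrite mxE expr2. Qed.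

Lemma sqr_norm2_le0 (K : realType) n (v : 'cV[K]_n) :
  norm2 v ^+ 2 <= 0 -> v = 0.
Proof.
rewrite sqr_norm2 => v_le0; apply/colP => i; rewrite mxE; apply/eqP.
rewrite -sqrf_eq0 eq_le sqr_ge0 andbT; apply: le_trans v_le0.
by rewrite (bigD1 i) //= lerDl sumr_ge0 // => j _; rewrite sqr_ge0.
Qed.

Lemma norm2_0 (K : realType) n : norm2 (0 : 'cV[K]_n) = 0.
Proof. by apply/eqP; rewrite -sqrf_eq0 sqr_norm2_mx mulmx0 mxE. Qed.

Lemma sqr_norm2Z (K : realType) n (a : K) (v : 'cV[K]_n) :
  norm2 (a *: v) ^+ 2 = a ^+ 2 * norm2 v ^+ 2.
Proof.
rewrite !sqr_norm2 mulr_sumr; apply: eq_bigr => i _.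
by rewrite mxE exprMn.
Qed.

Lemma parallelogram_norm2 (K : realType) n (u v : 'cV[K]_n) :
  norm2 (u + v) ^+ 2 + norm2 (u - v) ^+ 2
  = 2 * norm2 u ^+ 2 + 2 * norm2 v ^+ 2.
Proof.
rewrite !sqr_norm2 !mulr_sumr -!big_split /=; apply: eq_bigr => i _.
rewrite !mxE; ring.
Qed.

Lemma sqr_norm2_col_mx (K : realType) p q (u : 'cV[K]_p) (v : 'cV[K]_q) :
  norm2 (col_mx u v) ^+ 2 = norm2 u ^+ 2 + norm2 v ^+ 2.
Proof. by rewrite !sqr_norm2_mx tr_col_mx mul_row_col mxE. Qed.

Lemma norm2_orthogonal_tr (K : realType) n (U : 'M[K]_n) (v : 'cV[K]_n) :
  orthogonal_mx U -> norm2 (U^T *m v) ^+ 2 = norm2 v ^+ 2.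
Proof.
case=> _ UUt; rewrite !sqr_norm2_mx trmx_mul trmxK mulmxA.
by rewrite -(mulmxA v^T) UUt mulmx1.
Qed.

(** Since [1 - eps] is positive, the lower bound makes [S] injective on the column space of [B]. *)
Lemma subspace_embedding_ker (K : realType) m n k (eps : K)
    (S : 'M[K]_(m, n)) (B : 'M[K]_(n, k)) (z : 'cV[K]_k) :
  eps < 1 -> subspace_embedding eps S B -> S *m B *m z = 0 -> B *m z = 0.
Proof.
move=> eps1 /(_ z)[+ _] SBz0; rewrite SBz0 norm2_0 expr0n /=.
by rewrite pmulr_rle0 ?subr_gt0 //; exact: sqr_norm2_le0.
Qed.

(** Padding [z] with zeros switches off the block [C]; this passes from the augmented matrix to
    [A]. *)
Lemma subspace_embedding_row_mxl (K : realType) m n k l (eps : K)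
    (S : 'M[K]_(m, n)) (B : 'M[K]_(n, k)) (C : 'M[K]_(n, l)) :
  subspace_embedding eps S (row_mx B C) -> subspace_embedding eps S B.
Proof.
move=> emb z; have := emb (col_mx z 0).
by rewrite mul_mx_row !mul_row_col !mulmx0 !addr0.
Qed.

(* The midpoint of two minimisers with distinct images would have a strictly
   smaller residual, by the parallelogram identity. *)
Lemma lsq_solution_image (K : realType) n k (B : 'M[K]_(n, k)) (b : 'cV[K]_n)
    (x y : 'cV[K]_k) :
  lsq_solution B b x -> lsq_solution B b y -> B *m x = B *m y.
Proof.
move=> [_ xmin] [_ ymin].
have rxy : norm2 (B *m x - b) = norm2 (B *m y - b).
  by apply: le_anti; rewrite xmin // ymin.
have := xmin (2^-1 *: (x + y)) I.
have -> : B *m (2^-1 *: (x + y)) - b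
    = 2^-1 *: ((B *m x - b) + (B *m y - b)).
  by rewrite -scalemxAr mulmxDr; apply/colP => i; rewrite !mxE; field.
rewrite -ler_sqr ?nnegrE ?norm2_ge0 // sqr_norm2Z => mid.
have := parallelogram_norm2 (B *m x - b) (B *m y - b).
rewrite -rxy => par; apply/subr0_eq/sqr_norm2_le0.
have -> : B *m x - B *m y = (B *m x - b) - (B *m y - b).
  by rewrite opprB addrA subrK.
(* With [u], [v] the two residuals, [mid] gives |u+v|^2 >= 4|u|^2, while [par] reads |u+v|^2 +
   |u-v|^2 = 4|u|^2. *)
by move: mid par; set c := norm2 _ ^+ 2; lra.
Qed.

(* The number of columns d is written p + q, so that q = d - p. *)
Theorem theorem3p2p2 (K : realType) (m n p q : nat)
    (A : 'M[K]_(n, p + q)) (b : 'cV[K]_n) (S : 'M[K]_(m, n)) (eps : K)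
    (Q : 'M[K]_(m, p + q)) (R Vhat : 'M[K]_(p + q))
    (Q1 : 'M[K]_(m, p)) (Q2 : 'M[K]_(m, q))
    (R11 : 'M[K]_p) (R12 : 'M[K]_(p, q))
    (V1 : 'M[K]_(p + q, p)) (V2 : 'M[K]_(p + q, q))
    (W : 'M[K]_(n, p)) (ystar ytau : 'cV[K]_p) (xtau : 'cV[K]_(p + q)) :
  0 < eps -> eps < 1 ->
  subspace_embedding eps S (row_mx A b) ->
  S *m A = Q *m R *m Vhat^T ->
  R = block_mx R11 R12 0 0 ->
  Q = row_mx Q1 Q2 ->
  Vhat = row_mx V1 V2 ->
  R11 \in unitmx ->
  orthonormal_columns Q1 ->
  orthonormal_columns Q2 ->
  orthogonal_mx Vhat ->
  W = A *m V1 *m invmx R11 ->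
  lsq_solution W b ystar ->
  R12 = 0 ->
  ytau = ystar ->
  xtau = V1 *m invmx R11 *m ytau ->
  unique (min_norm_lsq_solution A b) xtau.
Proof.
move=> _ eps1 emb SA defR defQ defV R11u Q1o _ Vo defW ysol R120 ytauE defx.
have [VtV VVt] := Vo.
have [V11 V12 V21] : [/\ V1^T *m V1 = 1%:M, V1^T *m V2 = 0 & V2^T *m V1 = 0].
  move: VtV; rewrite defV tr_row_mx mul_col_row scalar_mx_block.
  by case/eq_block_mx.
(* Orthogonal splitting along the ranges of [V1] and [V2], read off from [Vhat *m Vhat^T = 1]. *)
have decV (x : 'cV_(p + q)) : x = V1 *m (V1^T *m x) + V2 *m (V2^T *m x).
  by rewrite !mulmxA -mulmxDl -mul_row_col -tr_row_mx -defV VVt mul1mx.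
have SAE : S *m A = Q1 *m R11 *m V1^T.
  rewrite SA defQ defR R120 defV tr_row_mx mul_row_block !mulmx0 !addr0.
  by rewrite mul_row_col mul0mx addr0.
have AV2 (z : 'cV_q) : A *m (V2 *m z) = 0.
  apply: (subspace_embedding_ker eps1 (subspace_embedding_row_mxl emb)).
  by rewrite SAE !mulmxA -(mulmxA _ V1^T) V12 mulmx0 mul0mx.
have AW (x : 'cV_(p + q)) : A *m x = W *m (R11 *m (V1^T *m x)).
  rewrite {1}(decV x) mulmxDr AV2 addr0 defW !mulmxA.
  by rewrite -(mulmxA _ _ R11) mulVmx // mulmx1.
have V1x : V1^T *m xtau = invmx R11 *m ytau.
  by rewrite defx !mulmxA V11 mul1mx.
have V2x : V2^T *m xtau = 0 by rewrite defx !mulmxA V21 !mul0mx.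
have xsol : lsq_solution A b xtau.
  (* By [AW], the residual of [A] at [z] is that of [W] at [R11 *m (V1^T *m z)], a point which for
     [xtau] is [ytau]; so optimality of [ystar] transfers. *)
  split=> // z _; rewrite !AW V1x mulKVmx // ytauE.
  by case: ysol => _; apply.
have sameV1 x : lsq_solution A b x -> V1^T *m x = V1^T *m xtau.
  move=> xs; have := lsq_solution_image xs xsol.
  (* By [SAE] and [Q1^T *m Q1 = 1], this multiplier sends [A] to [V1^T]. *)
  move/(congr1 (mulmx (invmx R11 *m Q1^T *m S))).
  rewrite !mulmxA -!(mulmxA _ S A) SAE !mulmxA -!(mulmxA _ Q1^T Q1) Q1o mulmx1.
  by rewrite mulVmx // mul1mx.
have pyth x : lsq_solution A b x ->
    norm2 x ^+ 2 = norm2 xtau ^+ 2 + norm2 (V2^T *m x) ^+ 2.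
  move=> xs; rewrite -(norm2_orthogonal_tr x Vo).
  rewrite -(norm2_orthogonal_tr xtau Vo) defV tr_row_mx !mul_col_mx.
  by rewrite !sqr_norm2_col_mx sameV1 // V2x norm2_0 expr0n addr0.
split.
  split=> // x xs; rewrite -ler_sqr ?nnegrE ?norm2_ge0 // (pyth x xs).
  by rewrite lerDl sqr_ge0.
(* Uniqueness: a competitor is no longer than [xtau], so by [pyth] its [V2] component vanishes, and
   [sameV1] fixes the other one. *)
move=> x [xs /(_ _ xsol)].
rewrite -ler_sqr ?nnegrE ?norm2_ge0 // (pyth x xs) gerDl => /sqr_norm2_le0 V2x0.
by rewrite (decV x) (decV xtau) V2x V2x0 sameV1.
Qed.
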